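(* Let $N\in\mathbb N$ and $M\in\mathbb N\cup\{0\}$, and let $\mathcal F$ be a nonempty, infinite collection of finite subsets of $\mathbb N$ that is $N$-covering and $M$-sliding. Then a basis $\mathcal B$ of a $p$-Banach space $X$ ($0<p\leqslant 1$) is $\mathcal F$-almost greedy if and only if it is almost greedy.
   Context: Let $\mathbb N=\{1,2,\dots\}$ and let $\mathbb N^{<\infty}$ be the collection of finite subsets of $\mathbb N$. A $p$-Banach space ($0<p\leqslant 1$) over $\mathbb F$ ($=\mathbb R$ or $\mathbb C$) is a vector space complete under a homogeneous, positive definite $\|\cdot\|$ with $\|x+y\|^p\leqslant\|x\|^p+\|y\|^p$. All spaces $X$ are separable and infinite dimensional; $X^*$ is the dual of $X$. A basis $\mathcal B$ of $X$ is a sequence $(e_n)_{n=1}^\infty\subset X$ whose span is dense in $X$, for which there is a unique sequence $(e_n^* )_n\subset X^*$ with $e_m^*(e_n)=\delta_{m,n}$ for all $m,n$, and such that $0<\inf_n\{\|e_n\|,\|e_n^*\|\}\leqslant\sup_n\{\|e_n\|,\|e_n^*\|\}<\infty$. For $A\in\mathbb N^{<\infty}$, $P_A(x)=\sum_{n\in A}e_n^*(x)e_n$. For $x\in X$ and an integer $m\geqslant 0$, $\Lambda_m(x)$ denotes any set with $|\Lambda_m(x)|=m$ and $\min_{n\in\Lambda_m(x)}|e_n^*(x)|\geqslant\max_{n\notin\Lambda_m(x)}|e_n^*(x)|$ (the choice need not be unique; $\Lambda_0(x)=\emptyset$), and $G_m(x)=P_{\Lambda_m(x)}(x)$. A basis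 is almost greedy if there is $C>0$ such that $\|x-G_m(x)\|\leqslant C\inf\{\|x-P_A(x)\|: A\subset\mathbb N,\ |A|=m\}$ for all $x\in X$, $m\in\mathbb N$ and all choices of $G_m(x)$. Put $\min\mathcal F:=\min_{F\in\mathcal F}|F|$. A basis is $\mathcal F$-almost greedy if there is $\Delta\geqslant 1$ such that $\|x-G_m(x)\|\leqslant\Delta\inf_{F\in\mathcal F,\,|F|\leqslant m}\|x-P_F(x)\|$ for all $x\in X$, all $m\in\mathbb N$ with $m\geqslant\min\mathcal F$, and all choices of $G_m(x)$. For $N\in\mathbb N$, $\mathcal F$ is $N$-covering if for every $B\in\mathbb N^{<\infty}$ there exist $F_1,\dots,F_N\in\mathcal F$ with $|B\setminus\bigcup_{i=1}^N F_i|\leqslant N$. For an integer $N\geqslant 0$, $\mathcal F$ is $N$-sliding if for every $K\in\mathbb N$ there is $F\in\mathcal F$ with $|F|\geqslant K$ and $|F\cap\{1,2,\dots,K\}|\leqslant N$. *)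

(* Defs.v *)
From mathcomp Require Import all_boot all_order all_algebra.
From mathcomp Require Import finmap complex.
From mathcomp Require Import all_classical all_reals all_analysis.

Set Implicit Arguments.
Unset Strict Implicit.
Unset Printing Implicit Defensive.

Import Order.TTheory GRing.Theory Num.Theory.
Import numFieldNormedType.Exports.

Local Open Scope classical_set_scope.
Local Open Scope ring_scope.

(* The norms of MathComp-Analysis satisfy the triangle inequality, so p-norms
   with p < 1 are set up here. They are real-valued, hence the real-valued
   modulus: the norm of R[i] in MathComp has its values in R[i]. *)
Variant scalar_kind := RealScalars | ComplexScalars.

Definition scalar_field (R : realType) (k : scalar_kind) : numFieldType :=
  match k with
  | RealScalars => R : numFieldType
  | ComplexScalars => R[i] : numFieldType
  end.

Definition modulus (R : realType) (k : scalar_kind) : scalar_field R k -> R :=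
  match k with
  | RealScalars => fun a : R => `|a|
  | ComplexScalars => fun a : R[i] => complex.Re `|a|
  end.

Section PBanach.
Context (R : realType) (k : scalar_kind).
Local Notation K := (scalar_field R k).

Definition lin_span (X : lmodType K) (D : set X) : set X :=
  [set x | exists n (a : 'I_n -> K) (v : 'I_n -> X),
     (forall i, D (v i)) /\ x = \sum_(i < n) a i *: v i].

Definition infinite_dimensional (X : lmodType K) : Prop :=
  ~ exists D : set X, finite_set D /\ lin_span D = setT.

Section Norm.
Context (X : lmodType K) (nrm : X -> R).

Definition norm_dense (D : set X) : Prop :=
  forall (x : X) (eps : R), 0 < eps -> exists2 y, D y & nrm (x - y) < eps.

Definition norm_complete : Prop :=
  forall u : nat -> X,
    (forall eps : R, 0 < eps -> exists N : nat, forall m n : nat,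
       (N <= m)%N -> (N <= n)%N -> nrm (u m - u n) < eps) ->
    exists x : X, nrm (u n - x) @[n --> \oo] --> (0 : R).

Record is_pBanach (p : R) : Prop := IsPBanach {
  pnorm_ge0 : forall x, 0 <= nrm x;
  pnorm_eq0 : forall x, nrm x = 0 -> x = 0;
  pnormZ : forall (a : K) x, nrm (a *: x) = modulus a * nrm x;
  pnorm_triangle : forall x y, nrm (x + y) `^ p <= nrm x `^ p + nrm y `^ p;
  pnorm_complete : norm_complete;
  pnorm_separable : exists2 D : set X, countable D & norm_dense D;
  pnorm_infinite : infinite_dimensional X }.

Definition dual_norm (f : X -> K) : \bar R :=
  ereal_sup [set (modulus (f x))%:E | x in [set x | nrm x <= 1]].

Definition in_dual (f : {linear X -> K^o}) : Prop := (dual_norm f < +oo)%E.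

(* The sequence (e_n), n = 1, 2, ..., is indexed by nat: the index i : nat
   stands for the positive integer i.+1. The same convention is used for the
   finite subsets of {1, 2, ...} below. *)
Definition biorthogonal (e : nat -> X) (f : nat -> {linear X -> K^o}) : Prop :=
  forall m n : nat, f m (e n) = (m == n)%:R.

Record is_basis (e : nat -> X) (f : nat -> {linear X -> K^o}) : Prop :=
  IsBasis {
  basis_dense : norm_dense (lin_span (range e));
  basis_dual : forall n, in_dual (f n);
  basis_biorth : biorthogonal e f;
  basis_unique : forall g : nat -> {linear X -> K^o},
    (forall n, in_dual (g n)) -> biorthogonal e g -> forall n, g n =1 f n;
  basis_inf :
    (0 < ereal_inf (range (fun n => (nrm (e n))%:E) `|`
                    range (fun n => dual_norm (f n))))%E;
  basis_sup :
    (ereal_sup (range (fun n => (nrm (e n))%:E) `|`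
                range (fun n => dual_norm (f n))) < +oo)%E }.

Context (e : nat -> X) (f : nat -> {linear X -> K^o}).

Definition coord_proj (A : {fset nat}) (x : X) : X := \sum_(n <- A) f n x *: e n.

(* L is one of the sets Lambda_m(x), and G_m(x) = coord_proj L x. *)
Definition greedy_set (x : X) (m : nat) (L : {fset nat}) : Prop :=
  #|` L|%fset = m /\
  forall i j, i \in L -> j \notin L -> modulus (f j x) <= modulus (f i x).

Definition almost_greedy : Prop :=
  exists2 C : R, 0 < C &
  forall (x : X) (m : nat) (L : {fset nat}),
    (0 < m)%N -> greedy_set x m L ->
    nrm (x - coord_proj L x) <=
      C * inf [set nrm (x - coord_proj A x) | A in [set A | #|` A|%fset = m]].

Definition min_card (FF : set {fset nat}) : nat :=
  xget 0%N [set c | (exists2 F, FF F & #|` F|%fset = c) /\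
                    forall F, FF F -> (c <= #|` F|%fset)%N].

Definition F_almost_greedy (FF : set {fset nat}) : Prop :=
  exists2 Delta : R, 1 <= Delta &
  forall (x : X) (m : nat) (L : {fset nat}),
    (0 < m)%N -> (min_card FF <= m)%N -> greedy_set x m L ->
    nrm (x - coord_proj L x) <=
      Delta * inf [set nrm (x - coord_proj F x) |
                   F in [set F | FF F /\ (#|` F|%fset <= m)%N]].

End Norm.
End PBanach.

Definition covering (N : nat) (FF : set {fset nat}) : Prop :=
  forall B : {fset nat}, exists F : 'I_N -> {fset nat},
    (forall i, FF (F i)) /\
    (#|` (B `\` \bigcup_(i <- enum 'I_N) F i)%fset|%fset <= N)%N.

(* With the shifted indices, {1, ..., K} is [set i | i < K]. *)
Definition sliding (N : nat) (FF : set {fset nat}) : Prop :=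
  forall K : nat, (0 < K)%N -> exists F : {fset nat},
    [/\ FF F, (K <= #|` F|%fset)%N &
        (#|` [fset i in F | (i < K)%N]%fset|%fset <= N)%N].

(* Main.v *)
Require Import Defs.
From mathcomp Require Import all_boot all_order all_algebra.
From mathcomp Require Import finmap complex.
From mathcomp Require Import all_classical all_reals all_analysis.
From mathcomp Require Import ring zify.

Import Order.TTheory GRing.Theory Num.Theory.
Import numFieldNormedType.Exports.
Local Open Scope classical_set_scope.
Local Open Scope ring_scope.

(** All estimates are made on q(x) = |x|^p (here [pn]), which is subadditive; an
inequality |x| <= D |y| between norms is one of the same shape between values
of q, so constants can be accumulated by addition.

If the basis is almost greedy and F has at most m elements, enlarge F by a set
E of m - |F| indices so far away that P_E(x) is negligible: the coefficients of
x tend to 0 because the span of the basis is dense and the coefficient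
functionals are uniformly bounded. The bound by |x - P_(F u E)(x)| then becomes
a bound by |x - P_F(x)| ([almost_greedy_le_card]).

Conversely, suppose that the basis is F-almost greedy. Comparing greedy sums
with one fixed projection P_F shows that the basis is quasi-greedy: q(x - G_m(x))
is at most a constant times q(x) ([F_greedy_quasi_greedy]). The main step is an
exchange inequality ([pn_lc_exchange]): let A lie in a member F of the
collection, let B be disjoint from F with |A| <= |B|, and let all coefficients
of a vector on A be at most t and all those of a vector on B at least t in
modulus. Although F can be much larger than A, the vector
  v = (a on A) + t (on F minus A) + (b on B)
has (F minus A) u B as a greedy set with at least |F| elements. Removing it
leaves a, and removing F leaves b, so q(a) <= D q(b).

Now let L be a greedy set of x, |A| = |L|, and u = x - P_A(x). Put A1 = A minus L
and L1 = L minus A. Then x - P_L(x) = (u - P_L1(u)) + P_A1(x), and quasi-greediness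
controls the first term since L1 is a greedy set of u. To control P_A1(x),
take t to be the smallest coefficient of u on L1, cover A1 by N members of the
collection up to N elements, and, by sliding, choose a member G that
meets a long initial segment in at most M elements. One exchange through G
passes from P_L1(u) to a constant vector t on a far away subset E of G with
|E| = |L1| ([pn_exchange_sliding]); as E is disjoint from the covering sets, an
exchange through each of them passes from E to the corresponding part of A1
([pn_lc_cover]). The at most M or N exceptional indices cost a bounded factor
each, all the coefficients involved being at most a constant times |u|. *)

(** * Scalars and finite sets *)

Section Modulus.
Context {R : realType} {k : scalar_kind}.
Local Notation K := (scalar_field R k).
Implicit Types a b : K.

Lemma modulus_complexE (z : R[i]) :
  @modulus R ComplexScalars z = Num.sqrt (complex.Re z ^+ 2 + complex.Im z ^+ 2).
Proof. exact: (congr1 (@complex.Re R) (normc_def z)). Qed.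

Lemma modulus_ge0 a : 0 <= modulus a.
Proof.
move: a; case: k => a; first exact: normr_ge0.
by rewrite modulus_complexE sqrtr_ge0.
Qed.

Lemma modulusM a b : modulus (a * b) = modulus a * modulus b.
Proof.
move: a b; case: k => a b; first exact: normrM.
rewrite !modulus_complexE -sqrtrM ?addr_ge0 ?sqr_ge0//.
by case: a b => [x y] [z t] /=; congr Num.sqrt; ring.
Qed.

Lemma modulus0 : modulus (0 : K) = 0.
Proof.
case: k; first exact: normr0.
by rewrite modulus_complexE /= expr0n addr0 sqrtr0.
Qed.

Lemma modulusN1 : modulus (-1 : K) = 1.
Proof.
case: k; first by rewrite /= normrN1.
by rewrite modulus_complexE /= oppr0 expr0n addr0 sqrrN expr1n sqrtr1.
Qed.

Lemma ex_modulus (r : R) : 0 <= r -> exists a, modulus a = r.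
Proof.
move=> r0; case: k; first by exists r; rewrite /= ger0_norm.
exists (r%:C)%C; rewrite modulus_complexE /= expr0n addr0 sqrtr_sqr.
exact: ger0_norm.
Qed.

End Modulus.

Lemma ex_fset_sub_card {T : choiceType} (S : {fset T}) (m : nat) :
  (m <= #|` S|)%N -> exists2 D : {fset T}, (D `<=` S)%fset & #|` D|%fset = m.
Proof.
move=> mS; pose s := take m (enum_fset S).
exists [fset i in s]%fset.
  by apply/fsubsetP => i; rewrite inE => /mem_take.
rewrite card_fseq undup_id ?take_uniq ?enum_fset_uniq// size_take.
by case: ltngtP mS.
Qed.

Lemma fset_nat_bounded (S : {fset nat}) :
  exists K, forall i, i \in S -> (i < K)%N.
Proof.
exists (\max_(i <- S) i).+1 => i iS; rewrite ltnS.
by rewrite (big_fsetD1 i iS) /= leq_maxl.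
Qed.

Lemma ex_fset_argmin {R : realType} (S : {fset nat}) (g : nat -> R) :
  S != fset0 -> exists2 n, n \in S & forall j, j \in S -> g n <= g j.
Proof.
case/fset0Pn => i0 i0S.
case: (arg_minP (fun n : S => g (val n)) (erefl : predT [` i0S]%fset)) => n _ hn.
exists (val n); first exact: valP.
by move=> j jS; exact: (hn [` jS]%fset erefl).
Qed.

(** For a nonempty collection the default value of [min_card] is not reached: a set
of cardinals then
has a least element. *)
Lemma min_cardP (FF : set {fset nat}) : FF !=set0 ->
  (exists2 F, FF F & #|` F|%fset = min_card FF) /\
  forall F, FF F -> (min_card FF <= #|` F|)%N.
Proof.
case=> F0 FF0; rewrite /min_card; set S := (X in xget _ X).
suff : S (xget 0%N S) by [].
apply: xgetPex.
pose P c := `[< exists2 F, FF F & #|` F|%fset = c >].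
have exP : exists c, P c by exists #|` F0|%fset; apply/asboolP; exists F0.
exists (ex_minn exP); case: ex_minnP => c /asboolP cP cmin; split=> // F FFF.
by apply: cmin; apply/asboolP; exists F.
Qed.

(** * The p-th power of a p-norm *)

Section Basis.
Context {R : realType} {k : scalar_kind}.
Local Notation K := (scalar_field R k).
Context {X : lmodType K} {nrm : X -> R} {p : R}.
Context (p_gt0 : 0 < p) (hX : is_pBanach nrm p).

(** The p-th power of the norm, rather than the norm, satisfies the triangle
inequality. *)
Definition pn (x : X) : R := nrm x `^ p.

Lemma pn_ge0 x : 0 <= pn x. Proof. exact: powR_ge0. Qed.

Lemma pnZ a x : pn (a *: x) = modulus a `^ p * pn x.
Proof. by rewrite /pn (pnormZ hX) powRM ?modulus_ge0 ?(pnorm_ge0 hX). Qed.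

Lemma pn0 : pn 0 = 0.
Proof. by rewrite -(scale0r (0 : X)) pnZ modulus0 powR0 ?mul0r ?gt_eqF. Qed.

Lemma pnD x y : pn (x + y) <= pn x + pn y.
Proof. exact: (pnorm_triangle hX). Qed.

Lemma nrmN x : nrm (- x) = nrm x.
Proof. by rewrite -scaleN1r (pnormZ hX) modulusN1 mul1r. Qed.

Lemma pnB x y : pn (x - y) <= pn x + pn y.
Proof. by rewrite (le_trans (pnD _ _))// /pn nrmN. Qed.

Lemma pn_sum (I : Type) (s : seq I) (F : I -> X) :
  pn (\sum_(i <- s) F i) <= \sum_(i <- s) pn (F i).
Proof.
elim: s => [|i s IH]; first by rewrite !big_nil pn0.
by rewrite !big_cons (le_trans (pnD _ _))// lerD2l.
Qed.

Lemma ler_powRp (s t : R) : 0 <= s -> s <= t -> s `^ p <= t `^ p.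
Proof.
move=> s0 st; apply: ge0_ler_powR; rewrite ?nnegrE ?(ltW p_gt0)//.
exact: le_trans st.
Qed.

Lemma nrm_le_pn (C : R) x y :
  0 <= C -> pn x <= C * pn y -> nrm x <= C `^ p^-1 * nrm y.
Proof.
move=> C0 h.
have root (s : R) : 0 <= s -> (s `^ p) `^ p^-1 = s.
  by move=> s0; rewrite -powRrM divff ?gt_eqF// powRr1.
have pV0 : 0 <= p^-1 by rewrite invr_ge0 ltW.
rewrite -[nrm x]root ?(pnorm_ge0 hX)// -[nrm y]root ?(pnorm_ge0 hX)//.
rewrite -powRM ?powR_ge0//.
by apply: ge0_ler_powR; rewrite ?nnegrE ?mulr_ge0 ?powR_ge0.
Qed.

Lemma pn_le_nrm (C : R) x y :
  0 <= C -> nrm x <= C * nrm y -> pn x <= C `^ p * pn y.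
Proof.
move=> C0 h; rewrite /pn -powRM ?(pnorm_ge0 hX)//.
by apply: ler_powRp; rewrite ?(pnorm_ge0 hX).
Qed.

(** [dual_norm] is a supremum over the unit ball, so the bound is obtained after
rescaling; the scalar used has modulus 1/|x| and exists in both fields. *)
Lemma dual_norm_bound (g : {linear X -> K^o}) (c : R) :
  (dual_norm nrm g <= c%:E)%E -> forall x, modulus (g x : K) <= c * nrm x.
Proof.
move=> gc x; have [x0|xN0] := eqVneq (nrm x) 0.
  by rewrite x0 mulr0 (pnorm_eq0 hX x0) linear0 modulus0.
have x_gt0 : 0 < nrm x by rewrite lt_neqAle eq_sym xN0 (pnorm_ge0 hX).
have [a ha] : exists a : K, modulus a = (nrm x)^-1.
  by apply: ex_modulus; rewrite invr_ge0 ltW.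
have : ((modulus (g (a *: x) : K))%:E <= c%:E)%E.
  apply: le_trans gc; apply: ereal_sup_ubound; exists (a *: x) => //=.
  by rewrite (pnormZ hX) ha mulVf.
by rewrite lee_fin linearZ /= modulusM ha ler_pdivrMl// mulrC.
Qed.

Lemma basis_bounds {e : nat -> X} {f : nat -> {linear X -> K^o}} :
  is_basis nrm e f ->
  exists c : R, [/\ 0 <= c, (forall n, nrm (e n) <= c) &
    forall n x, modulus (f n x : K) <= c * nrm x].
Proof.
move=> /basis_sup; set S := (X in ereal_sup X) => Sfin.
have Sge0 : (0%:E <= ereal_sup S)%E.
  apply: (@le_trans _ _ (nrm (e 0%N))%:E); first by rewrite lee_fin (pnorm_ge0 hX).
  by apply: ereal_sup_ubound; left; exists 0%N.
have Sfn : ereal_sup S \is a fin_num by rewrite ge0_fin_numE.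
exists (fine (ereal_sup S)); split; first exact: fine_ge0.
- move=> n; rewrite -lee_fin fineK//.
  by apply: ereal_sup_ubound; left; exists n.
- move=> n; apply: dual_norm_bound; rewrite fineK//.
  by apply: ereal_sup_ubound; right; exists n.
Qed.

(** The next two lemmas let the greedy inequalities be handled one competitor at
a time and for q instead of the norm. In the second one, the summand 1 makes
the constant at least 1, as an F-almost greedy basis requires. *)
Lemma pn_le_of_inf (S : set {fset nat}) (g : {fset nat} -> X) y (D : R) :
  0 <= D -> nrm y <= D * inf [set nrm (g A) | A in S] ->
  forall A, S A -> pn y <= D `^ p * pn (g A).
Proof.
move=> D0 h A SA; apply: pn_le_nrm => //; apply: le_trans h _.
apply: ler_wpM2l => //; apply: ge_inf; last by exists A.
by exists 0 => _ [B _ <-]; exact: (pnorm_ge0 hX).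
Qed.

Lemma inf_le_of_pn (S : set {fset nat}) (g : {fset nat} -> X) y (D : R) :
  S !=set0 -> 0 <= D -> (forall A, S A -> pn y <= D * pn (g A)) ->
  nrm y <= (1 + D `^ p^-1) * inf [set nrm (g A) | A in S].
Proof.
move=> [A0 SA0] D0 h.
have D1 : 0 < 1 + D `^ p^-1 by rewrite ltr_wpDr ?powR_ge0.
rewrite -ler_pdivrMl//; apply: lb_le_inf; first by exists (nrm (g A0)), A0.
move=> _ [A SA <-]; rewrite ler_pdivrMl// mulrDl mul1r.
by rewrite ler_wpDl ?(pnorm_ge0 hX)//; exact: nrm_le_pn (h A SA).
Qed.

(** * Finite combinations of basis vectors *)

Section Combinations.
Context (e : nat -> X) (f : nat -> {linear X -> K^o}) (c : R).
Context (fe : biorthogonal e f) (c_ge0 : 0 <= c).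
Context (e_le : forall n, nrm (e n) <= c).
Context (f_le : forall n x, modulus (f n x : K) <= c * nrm x).

(** Projections are the case where [a] is the coefficient family of a vector;
arbitrary families are needed for the vectors built in the exchanges. *)
Definition lc (a : nat -> K) (S : {fset nat}) : X := \sum_(n <- S) a n *: e n.

Definition kappa : R := (c * c) `^ p.

Lemma kappa_ge0 : 0 <= kappa. Proof. exact: powR_ge0. Qed.

Lemma coord_projE S x : coord_proj e f S x = lc (fun n => f n x : K) S.
Proof. by []. Qed.

Lemma eq_lc a b S : (forall n, n \in S -> a n = b n) -> lc a S = lc b S.
Proof. by move=> ab; apply: eq_big_seq => n /ab ->. Qed.

Lemma lc0 a : lc a fset0 = 0. Proof. exact: big_seq_fset0. Qed.

Lemma lcID (T S : {fset nat}) a : lc a S = lc a (S `&` T)%fset + lc a (S `\` T)%fset.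
Proof.
rewrite /lc (big_fsetID _ (fun n => n \in T)) /=; congr (_ + _).
  by apply: eq_fbigl => n; rewrite !inE.
by apply: eq_fbigl => n; rewrite !inE andbC.
Qed.

Lemma coef_lc a S j : (f j (lc a S) : K) = if j \in S then a j else 0.
Proof.
rewrite /lc linear_sum /=.
have E n : f j (a n *: e n) = a n * (j == n)%:R by rewrite linearZ /= fe.
case: ifPn => jS.
  rewrite (big_fsetD1 j jS) /= E eqxx mulr1 big1_seq ?addr0// => n /=.
  by rewrite !inE E eq_sym => /andP[/negPf -> _]; rewrite mulr0.
rewrite big1_seq// => n /= nS; rewrite E; case: eqP => [jn|_]; last by rewrite mulr0.
by rewrite jn nS in jS.
Qed.

Lemma coord_proj_lc a S T : coord_proj e f T (lc a S) = lc a (S `&` T)%fset.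
Proof.
rewrite coord_projE (lcID S) fsetIC [X in _ + X]big1_seq ?addr0; last first.
  by move=> n /=; rewrite !inE coef_lc => /andP[/negPf -> _]; rewrite scale0r.
by apply: eq_lc => n; rewrite !inE coef_lc => /andP[->].
Qed.

Lemma coef_proj_compl S x j :
  (f j (x - coord_proj e f S x) : K) = if j \in S then 0 else f j x.
Proof.
by rewrite linearB /= coord_projE coef_lc; case: ifP; rewrite ?subrr ?subr0.
Qed.

(** The vector [x] serves only as a yardstick: its norm dominates the coefficients,
and it may be unrelated to the combination. This bounds the contribution of a
few exceptional indices, and also that of a projection of a vector which agrees
with [x] far away. *)
Lemma pn_lc_le a S x : (forall n, n \in S -> modulus (a n) <= c * nrm x) ->
  pn (lc a S) <= #|` S|%:R * (kappa * pn x).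
Proof.
move=> h; apply: le_trans (pn_sum _ _ _) _.
have -> : #|` S|%:R * (kappa * pn x) = \sum_(n <- S) kappa * pn x.
  by rewrite big_const_seq count_predT iter_addr_0 mulr_natl.
rewrite big_seq [leRHS]big_seq ler_sum// => n nS.
rewrite /kappa /pn -powRM ?mulr_ge0 ?(pnorm_ge0 hX)//.
apply: ler_powRp; rewrite ?(pnorm_ge0 hX)// (pnormZ hX).
by rewrite mulrAC ler_pM ?modulus_ge0 ?(pnorm_ge0 hX)// h.
Qed.

Lemma pn_proj_le S x : pn (coord_proj e f S x) <= #|` S|%:R * (kappa * pn x).
Proof. by apply: pn_lc_le => n _; exact: f_le. Qed.

Lemma lc_proj_compl a S T : lc a S - coord_proj e f T (lc a S) = lc a (S `\` T)%fset.
Proof. by rewrite coord_proj_lc (lcID T S) addrAC subrr add0r. Qed.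

(** * Greedy inequalities *)

(** The condition m >= min F is implied by the presence of a competitor F with at
most m elements. *)
Definition F_greedy_ineq (FF : set {fset nat}) (D : R) : Prop :=
  forall x m L F, (0 < m)%N -> greedy_set f x m L ->
    FF F -> (#|` F| <= m)%N ->
    pn (x - coord_proj e f L x) <= D * pn (x - coord_proj e f F x).

Definition almost_greedy_ineq (D : R) : Prop :=
  forall x m L A, (0 < m)%N -> greedy_set f x m L -> #|` A|%fset = m ->
    pn (x - coord_proj e f L x) <= D * pn (x - coord_proj e f A x).

Lemma F_almost_greedyE (FF : set {fset nat}) : FF !=set0 ->
  F_almost_greedy nrm e f FF <-> exists2 D : R, 0 <= D & F_greedy_ineq FF D.
Proof.
move=> FF0; have [[F0 FFF0 cF0] mincard_le] := min_cardP FF FF0.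
split=> [[D D1 hD]|[D D0 hD]].
  exists (D `^ p) => [|x m L F m0 hL FFF Fm]; first exact: powR_ge0.
  have minm := leq_trans (mincard_le _ FFF) Fm.
  exact: (pn_le_of_inf _ _ _ _ (le_trans ler01 D1) (hD x m L m0 minm hL) F (conj FFF Fm)).
exists (1 + D `^ p^-1) => [|x m L m0 minm hL]; first by rewrite lerDl powR_ge0.
apply: inf_le_of_pn => // [|F [FFF Fm]]; last exact: hD FFF Fm.
by exists F0; split=> //; rewrite cF0.
Qed.

Lemma almost_greedyE :
  almost_greedy nrm e f <-> exists2 D : R, 0 <= D & almost_greedy_ineq D.
Proof.
split=> [[D D0 hD]|[D D0 hD]].
  exists (D `^ p) => [|x m L A m0 hL cA]; first exact: powR_ge0.
  exact: (pn_le_of_inf _ _ _ _ (ltW D0) (hD x m L m0 hL) A cA).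
exists (1 + D `^ p^-1) => [|x m L m0 hL]; first by rewrite ltr_wpDr ?powR_ge0.
apply: inf_le_of_pn => // [|A cA]; last exact: hD hL cA.
by exists L; case: hL.
Qed.

(** * From F-almost greedy to almost greedy *)

Section FGreedy.
Context (FF : set {fset nat}) (D : R).
Context (D_ge0 : 0 <= D) (hFF : F_greedy_ineq FF D).

Definition quasi_greedy_ineq (C : R) : Prop :=
  forall x m L, greedy_set f x m L -> pn (x - coord_proj e f L x) <= C * pn x.

(** A fixed member F serves as competitor for every greedy set with at least |F|
elements; smaller sets have projections bounded in terms of |F| alone. *)
Lemma F_greedy_quasi_greedy F : FF F ->
  quasi_greedy_ineq ((1 + D) * (1 + #|` F|%:R * kappa)).
Proof.
move=> FFF x m L hL.
have proj_compl S : (#|` S| <= #|` F|)%N ->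
    pn (x - coord_proj e f S x) <= (1 + #|` F|%:R * kappa) * pn x.
  move=> SF; rewrite (le_trans (pnB _ _))// mulrDl mul1r lerD2l.
  rewrite (le_trans (pn_proj_le _ _))// -mulrA ler_wpM2r ?ler_nat//.
  by rewrite mulr_ge0 ?kappa_ge0 ?pn_ge0.
rewrite mulrDl mul1r mulrDl.
have T0 : 0 <= (1 + #|` F|%:R * kappa) * pn x.
  by rewrite mulr_ge0 ?pn_ge0// addr_ge0// mulr_ge0 ?kappa_ge0.
have DT0 := mulr_ge0 D_ge0 T0; rewrite -[D * _ * _]mulrA.
have [LF|FL] := leqP #|` L| #|` F|.
  by apply: le_trans (proj_compl _ LF) _; rewrite lerDl.
have [Lm _] := hL; have m0 : (0 < m)%N by rewrite -Lm; case: #|` L|%fset FL.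
have Fm : (#|` F| <= m)%N by rewrite -Lm ltnW.
apply: le_trans (hFF _ _ _ _ m0 hL FFF Fm) _.
by apply: ler_wpDl => //; apply: ler_wpM2l => //; apply: proj_compl.
Qed.

(** Both (F minus A) u B and F may be removed from the same vector, the first as a
greedy set; filling F minus A with the intermediate value t makes the greedy set
at least as large as F, however large F is compared with A and B. *)
Lemma pn_lc_exchange F A B a b (t : K) :
  FF F -> (A `<=` F)%fset -> [disjoint B & F]%fset -> (#|` A| <= #|` B|)%N ->
  (forall i, i \in A -> modulus (a i) <= modulus t) ->
  (forall j, j \in B -> modulus t <= modulus (b j)) ->
  pn (lc a A) <= D * pn (lc b B).
Proof.
move=> FFF AF BF AB at_ tb.
have [A0|[i0 i0A]] := fset_0Vmem A.
  by rewrite A0 lc0 pn0 mulr_ge0 ?pn_ge0.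
have AFP i : i \in A -> i \in F by move/fsubsetP: AF => /[apply].
have BFP i : i \in B -> i \notin F by move/fdisjointP: BF => /[apply].
pose c' n := if n \in A then a n else if n \in B then b n else t.
pose L := ((F `\` A) `|` B)%fset.
have FAL : (#|` F| <= #|` L|)%N.
  have FAB : [disjoint F `\` A & B]%fset.
    apply/fdisjointP => i; rewrite inE => /andP[_ iF]; apply/negP => /BFP.
    by rewrite iF.
  rewrite /L cardfsU (disjoint_fsetI0 FAB) cardfs0 subn0 cardfsDS//.
  by have := fsubset_leq_card AF; lia.
have F_gt0 : (0 < #|` F|)%N by rewrite cardfs_gt0; apply/fset0Pn; exists i0; exact: AFP.
have L_gt0 : (0 < #|` L|)%N := leq_trans F_gt0 FAL.
have gL : greedy_set f (lc c' (F `|` B)%fset) #|` L| L.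
  split=> // i j iL jL; rewrite !coef_lc.
  have -> : i \in (F `|` B)%fset.
    by move: iL; rewrite !inE => /orP[/andP[_ ->]//|->]; rewrite orbT.
  have ti : modulus t <= modulus (c' i).
    move: iL; rewrite !inE /c' => /orP[/andP[/negPf -> iF]|iB].
      by case: ifP => [/tb|].
    have /negPf -> : i \notin A by apply/negP => /AFP; apply/negP/BFP.
    by rewrite iB tb.
  apply: le_trans ti; case: ifPn => [jFB|_]; last by rewrite modulus0 modulus_ge0.
  have jA : j \in A.
    move: jL jFB; rewrite !inE negb_or negb_and negbK => /andP[/orP[//|/negPf ->]].
    by move=> /negPf ->.
  by rewrite /c' jA at_.
have := hFF _ _ _ _ L_gt0 gL FFF FAL; rewrite !lc_proj_compl.
have -> : lc c' ((F `|` B) `\` L)%fset = lc a A.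
  have -> : ((F `|` B) `\` L)%fset = A.
    apply/fsetP => i; rewrite !inE.
    have [iA|iA] := boolP (i \in A); have [iB|iB] := boolP (i \in B);
      have [iF|iF] := boolP (i \in F) => //=.
    - by move: (BFP _ iB); rewrite iF.
    - by move: (AFP _ iA); rewrite (negPf iF).
    - by move: (AFP _ iA); rewrite (negPf iF).
  by apply: eq_lc => n nA; rewrite /c' nA.
have -> // : lc c' ((F `|` B) `\` F)%fset = lc b B.
have -> : ((F `|` B) `\` F)%fset = B.
  by rewrite fsetDUl fsetDv fset0U; apply/fsetDidPl.
apply: eq_lc => n nB; rewrite /c' nB.
by have /negPf -> : n \notin A by apply/negP => /AFP; apply/negP/BFP.
Qed.

(** Splitting S along a list of covering sets; the uncovered remainder is paid for
index by index. *)
Lemma pn_lc_cover (s : seq {fset nat}) (S : {fset nat}) a n (T U : R) :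
  0 <= U ->
  (forall F A, F \in s -> (A `<=` S)%fset -> (A `<=` F)%fset -> pn (lc a A) <= T) ->
  (forall A, (A `<=` S)%fset -> pn (lc a A) <= #|` A|%:R * U) ->
  (#|` (S `\` \bigcup_(F <- s) F)| <= n)%fset%N ->
  pn (lc a S) <= (size s)%:R * T + n%:R * U.
Proof.
move=> U0; elim: s S => [|F s IH] S hT hU.
  rewrite big_nil fsetD0 mul0r add0r => Sn.
  by apply: le_trans (hU S (fsubset_refl _)) _; rewrite ler_wpM2r ?ler_nat.
rewrite big_cons -fsetDDl => Sn.
rewrite (lcID F) (le_trans (pnD _ _))// [size _]/= -natr1 mulrDl mul1r.
rewrite -addrA [T + _]addrC addrA [leRHS]addrC.
apply: lerD; first by apply: (hT F); rewrite ?mem_head ?fsubsetIl ?fsubsetIr.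
apply: IH => // [G A Gs AS|A AS]; last first.
  by apply: hU; apply: fsubset_trans AS (fsubsetDl _ _).
by apply: hT; [rewrite in_cons Gs orbT|exact: fsubset_trans AS (fsubsetDl _ _)].
Qed.

(** A member G of the collection, given by sliding, meets L and S in at most M
indices, so the part of L outside G can be exchanged with far away elements of
G. The set E is chosen to avoid S so that it can in turn be exchanged with the
covering sets. *)
Lemma pn_exchange_sliding (M : nat) (C : R) : sliding M FF -> quasi_greedy_ineq C ->
  0 <= C -> forall u L S t, greedy_set f u #|` L| L -> t \in L ->
  (forall j, j \in L -> modulus (f t u : K) <= modulus (f j u : K)) ->
  exists E : {fset nat}, [/\ [disjoint E & S]%fset, #|` E|%fset = #|` L|%fset &
    pn (lc (fun=> f t u : K) E) <= (D * (1 + C + M%:R * kappa) + M%:R * kappa) * pn u].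
Proof.
move=> hsl hC C0 u L S t gL tL tmin.
have k0 := kappa_ge0; have u0 := pn_ge0 u.
have [K1 hK1] := fset_nat_bounded (L `|` S)%fset.
(* K1 exceeds L and S; the extra |L| + M leave room in G, outside its at most M
   small elements, for a set E of |L| elements. *)
have [|G [FG GK GM]] := hsl (K1 + #|` L| + M).+1; first by [].
set K2 := (K1 + #|` L| + M).+1 in GK GM.
set G0 := [fset i in G | (i < K2)%N]%fset in GM.
have G0G : (G0 `<=` G)%fset by apply/fsubsetP => i; rewrite !inE => /andP[].
have LG0 i : i \in (L `|` S)%fset -> i \in G -> i \in G0.
  by move=> /hK1 iK iG; rewrite !inE iG /= /K2; lia.
have [|E EG cE] := @ex_fset_sub_card _ (G `\` G0)%fset #|` L|.
  by rewrite cardfsDS//; rewrite /K2 in GK; lia.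
have EP i : i \in E -> (i \in G) && (i \notin (L `|` S)%fset).
  move=> iE; have := fsubsetP EG _ iE; rewrite [in X in X -> _]inE => /andP[iG0 iG].
  by rewrite iG; apply: contra iG0 => /LG0; apply.
exists E; split=> //.
  apply/fdisjointP => i /EP /andP[_]; rewrite inE negb_or.
  by case/andP.
have LGM : (#|` (L `&` G)%fset| <= M)%N.
  apply: leq_trans GM; apply: fsubset_leq_card; apply/fsubsetP => i.
  by rewrite inE => /andP[iL iG]; apply: LG0 => //; rewrite inE iL.
(* L may meet G in up to M indices, so only a subset E1 of E of the size of
   L minus G is reached by the exchange; the rest of E has at most M elements. *)
have [|E1 E1E cE1] := @ex_fset_sub_card _ E #|` (L `\` G)%fset|.
  by rewrite cE fsubset_leq_card// fsubsetDl.
pose b n : K := f n u.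
have sumM S1 a : (#|` S1| <= M)%N ->
    (forall n, n \in S1 -> modulus (a n) <= c * nrm u) ->
    pn (lc a S1) <= M%:R * kappa * pn u.
  move=> S1M ha; apply: le_trans (pn_lc_le _ _ _ ha) _.
  by rewrite -mulrA ler_wpM2r ?mulr_ge0// ler_nat.
have hb : pn (lc b (L `\` G)%fset) <= (1 + C + M%:R * kappa) * pn u.
  have -> : lc b (L `\` G)%fset = u - (u - lc b L) - lc b (L `&` G)%fset.
    by rewrite (lcID G L) opprB addrCA subrr addr0 addrAC subrr add0r.
  rewrite mulrDl (le_trans (pnB _ _))// lerD//; last first.
    by apply: sumM => // n _; exact: f_le.
  rewrite mulrDl mul1r (le_trans (pnB _ _))// lerD2l.
  exact: hC gL.
have hE1 : pn (lc (fun=> b t) E1) <= D * pn (lc b (L `\` G)%fset).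
  apply: (pn_lc_exchange G _ _ _ _ (b t)) => //.
  - by apply: fsubset_trans E1E _; apply: fsubset_trans EG (fsubsetDl _ _).
  - by apply/fdisjointP => i; rewrite inE => /andP[].
  - by rewrite cE1.
  - by move=> j; rewrite inE => /andP[_ /tmin].
rewrite (lcID E1 E) (fsetIidPr E1E) (le_trans (pnD _ _))// mulrDl lerD//.
  by rewrite (le_trans hE1)// -mulrA ler_wpM2l.
apply: sumM => [|n _]; last exact: f_le.
by rewrite cardfsDS// cE cE1 -(cardfsID G L) addnK.
Qed.

Lemma F_greedy_almost_greedy (N M : nat) (C : R) :
  covering N FF -> sliding M FF -> quasi_greedy_ineq C -> 0 <= C ->
  exists2 C' : R, 0 <= C' & almost_greedy_ineq C'.
Proof.
move=> hcov hsl hC C0; have k0 := kappa_ge0.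
pose T0 : R := D * (1 + C + M%:R * kappa) + M%:R * kappa.
have T00 : 0 <= T0 by rewrite !(addr_ge0, mulr_ge0).
exists (C + (N%:R * (D * T0) + N%:R * kappa)).
  by rewrite !(addr_ge0, mulr_ge0).
move=> x m L A _ [cL hL] cA; set u := x - coord_proj e f A x.
have u0 := pn_ge0 u.
pose b n : K := f n x.
have fu n : n \notin A -> (f n u : K) = b n.
  by move=> nA; rewrite coef_proj_compl (negPf nA).
set A1 := (A `\` L)%fset; set L1 := (L `\` A)%fset.
have cA1 : (#|` A1| = #|` L1|)%fset.
  by rewrite !cardfsD cA cL fsetIC.
have gL1 : greedy_set f u #|` L1| L1.
  split=> // i j; rewrite !inE negb_and negbK => /andP[iA iL].
  rewrite [in leRHS]fu// coef_proj_compl; case: ifPn => /= [_ _|jA jL].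
    by rewrite modulus0 modulus_ge0.
  exact: hL.
(* Both sides are x minus the projections onto A cap L and L1: on the right the two
   copies of P_A1(x) cancel. *)
have -> : x - coord_proj e f L x = (u - coord_proj e f L1 u) + lc b A1.
  have -> : coord_proj e f L1 u = lc b L1.
    by apply: eq_lc => n; rewrite inE => /andP[/fu].
  rewrite /u !coord_projE (lcID A L) (lcID L A) -/b -/A1 -/L1 fsetIC.
  by rewrite [in RHS]addrAC !opprD !addrA addrNK.
rewrite (le_trans (pnD _ _))// mulrDl lerD//; first exact: hC gL1.
have [A10|A1N0] := eqVneq A1 fset0.
  by rewrite A10 lc0 pn0 !(addr_ge0, mulr_ge0).
have L1N0 : L1 != fset0 by rewrite -cardfs_gt0 -cA1 cardfs_gt0.
have [t tL1 tmin] := ex_fset_argmin L1 (fun n => modulus (f n u : K)) L1N0.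
have A1t i : i \in A1 -> modulus (b i) <= modulus (f t u : K).
  move: tL1; rewrite !inE => /andP[tA tL] /andP[iL iA].
  by rewrite fu//; exact: hL.
have [F [FFF cF]] := hcov A1.
pose s := [seq F i | i <- enum 'I_N].
have [E [ES cE hE]] := pn_exchange_sliding M C hsl hC C0 u L1
  (\bigcup_(G <- s) G)%fset t gL1 tL1 tmin.
have -> : (N%:R * (D * T0) + N%:R * kappa) * pn u =
    (size s)%:R * (D * (T0 * pn u)) + N%:R * (kappa * pn u).
  by rewrite size_map size_enum_ord; ring.
apply: pn_lc_cover; rewrite ?mulr_ge0//.
- move=> G A2 Gs A2A A2G.
  apply: le_trans (_ : D * pn (lc (fun=> f t u : K) E) <= _); last exact: ler_wpM2l.
  apply: (pn_lc_exchange G _ _ _ _ (f t u)) => //.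
  + by move: Gs => /mapP[i _ ->].
  + apply/fdisjointP => i iE; apply/negP => iG.
    move/fdisjointP: ES => /(_ _ iE) /negP; apply.
    by apply/bigfcupP; exists G => //; rewrite Gs.
  + by rewrite cE -cA1 fsubset_leq_card.
  + by move=> i /(fsubsetP A2A)/A1t.
- move=> A2 A2A; apply: pn_lc_le => n /(fsubsetP A2A)/A1t h.
  exact: le_trans h (f_le _ _).
- by rewrite big_map.
Qed.

End FGreedy.
(** * From almost greedy to F-almost greedy *)

(** Far away, the coefficients of x are those of x - y for any y in the span of the
basis, and x - y may be taken as small as wished, depending on the number j of
indices. *)
Lemma far_coord_proj_small x (j K : nat) (eps : R) :
  norm_dense nrm (lin_span (range e)) -> 0 < eps ->
  exists E : {fset nat}, [/\ #|` E|%fset = j, (forall i, i \in E -> (K <= i)%N) &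
    pn (coord_proj e f E x) <= eps].
Proof.
move=> hd eps0; have k0 := kappa_ge0.
have d0 : 0 < eps / (j%:R * kappa + 1).
  by rewrite divr_gt0// ltr_wpDl// mulr_ge0.
have [|y [n [a [v [hv ->]]]] hy] := hd x ((eps / (j%:R * kappa + 1)) `^ p^-1).
  by rewrite powR_gt0.
set z := x - _ in hy.
(* The 1 in the denominator covers the case j = 0. *)
have zp : pn z <= eps / (j%:R * kappa + 1).
  apply: le_trans (ler_powRp _ _ (pnorm_ge0 hX z) (ltW hy)) _.
  by rewrite -powRrM mulVf ?gt_eqF// powRr1// ltW.
have [g hg] : {g : 'I_n -> nat & forall i, e (g i) = v i}.
  by apply: (@choice _ _ (fun i m => e m = v i)) => i; have [m _ <-] := hv i; exists m.
have [K1 hK1] := fset_nat_bounded [fset g i | i in 'I_n]%fset.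
have fz m : (K1 <= m)%N -> f m x = f m z.
  move=> Km; rewrite /z linearB /= linear_sum /= big1 ?subr0// => i _.
  rewrite linearZ /= -hg fe; case: eqP => [mg|_]; last by rewrite scaler0.
  have gi : g i \in [fset g i | i in 'I_n]%fset by apply/imfsetP; exists i.
  by have := hK1 _ gi; rewrite -mg ltnNge Km.
pose E := [fset i in iota (K + K1) j]%fset.
have cE : #|` E|%fset = j by rewrite card_fseq undup_id ?iota_uniq// size_iota.
have EP i : i \in E -> (K + K1 <= i)%N.
  by rewrite inE /= mem_iota => /andP[].
exists E; split=> // [i /EP|]; first by apply: leq_trans; rewrite leq_addr.
apply: le_trans (pn_lc_le _ _ z _) _.
  by move=> i /EP Ei; rewrite fz ?f_le// (leq_trans _ Ei)// leq_addl.
rewrite cE mulrA (le_trans (ler_wpM2l _ zp)) ?mulr_ge0//.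
rewrite mulrCA ler_piMr ?(ltW eps0)// ler_pdivrMr ?mul1r ?lerDl//.
by rewrite ltr_wpDl// mulr_ge0.
Qed.

(** Competitors of size exactly m can imitate smaller ones: the additional indices
may be placed where x has negligible coordinates. *)
Lemma almost_greedy_le_card (D : R) :
  norm_dense nrm (lin_span (range e)) -> 0 <= D ->
  almost_greedy_ineq D -> F_greedy_ineq setT D.
Proof.
move=> hd D0 hag x m L F m0 hL _ Fm; apply/ler_addgt0Pr => eps eps0.
have [K hK] := fset_nat_bounded F.
have [|E [cE EK hE]] := far_coord_proj_small x (m - #|` F|) K (eps / (D + 1)) hd.
  by rewrite divr_gt0// ltr_wpDl.
have FE : [disjoint F & E]%fset.
  by apply/fdisjointP => i /hK iK; apply/negP => /EK; rewrite leqNgt iK.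
have cFE : #|` (F `|` E)%fset|%fset = m.
  by rewrite cardfsU (disjoint_fsetI0 FE) cardfs0 subn0 cE subnKC.
apply: le_trans (hag _ _ _ _ m0 hL cFE) _.
have -> : x - coord_proj e f (F `|` E)%fset x =
    x - coord_proj e f F x - coord_proj e f E x.
  rewrite !coord_projE (lcID F (F `|` E)%fset) opprD addrA fsetIC fsetKU.
  congr (_ - lc _ _); rewrite fsetDUl fsetDv fset0U; apply/fsetDidPl.
  by rewrite fdisjoint_sym.
apply: le_trans (ler_wpM2l D0 (pnB _ _)) _; rewrite mulrDr lerD2l.
apply: le_trans (ler_wpM2l D0 hE) _.
rewrite mulrCA ler_piMr ?(ltW eps0)// ler_pdivrMr ?ltr_wpDl// mul1r.
by rewrite lerDl.
Qed.

End Combinations.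
End Basis.

Theorem theorem2p3 (N M : nat) (FF : set {fset nat})
  (hN : (0 < N)%N) (hFF0 : FF !=set0) (hFFinf : infinite_set FF)
  (hcov : covering N FF) (hslide : sliding M FF)
  (R : realType) (k : scalar_kind) (p : R) (hp0 : 0 < p) (hp1 : p <= 1)
  (X : lmodType (scalar_field R k)) (nrm : X -> R) (hX : is_pBanach nrm p)
  (e : nat -> X) (f : nat -> {linear X -> (scalar_field R k)^o})
  (hB : is_basis nrm e f) :
  F_almost_greedy nrm e f FF <-> almost_greedy nrm e f.
Proof.
have [c [c0 ec fc]] := basis_bounds hX hB.
have fe := basis_biorth hB.
split.
  move/(F_almost_greedyE hp0 hX e f FF hFF0) => [D D0 hD].
  apply/(almost_greedyE hp0 hX).
  have [F FFF] := hFF0.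
  have hC := F_greedy_quasi_greedy hp0 hX e f c c0 ec fc FF D D0 hD F FFF.
  have [|C' C'0 hC'] := F_greedy_almost_greedy hp0 hX e f c fe c0 ec fc FF D D0 hD
    N M _ hcov hslide hC.
    by rewrite !(addr_ge0, mulr_ge0)// kappa_ge0.
  by exists C'.
move/(almost_greedyE hp0 hX) => [D D0 hD].
apply/(F_almost_greedyE hp0 hX e f FF hFF0); exists D => // x m L F m0 hL _ Fm.
exact: (almost_greedy_le_card hp0 hX e f c fe c0 ec fc D (basis_dense hB) D0 hD x m L F m0
  hL Logic.I Fm).
Qed.
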